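(* Let $n\ge 2$ and let $R=(r_{ij})$ be an $n\times n$ correlation matrix. Put $$r_2=\sqrt{\frac{\sum_{i\ne j}|r_{ij}|^2}{n(n-1)}}.$$ Let $\widehat{R}$ be the $n\times n$ matrix whose diagonal entries are all $1$ and whose off-diagonal entries are all $r_2$, and let $\overline{R}$ be the $n\times n$ matrix whose diagonal entries are all $1$ and whose off-diagonal entries are all $-r_2$. Then $$\lambda(\overline{R})\stackrel{vm}{\succ}\lambda(R)\stackrel{vm}{\succ}\lambda(\widehat{R}).$$
   Context: A correlation matrix is a real symmetric positive semidefinite matrix all of whose diagonal entries equal $1$. The sum $\sum_{i\neq j}$ runs over all ordered pairs $(i,j)$ with $1\le i,j\le n$ and $i\ne j$. For an $n\times n$ real symmetric matrix $A$, $\lambda(A)=(\lambda_1(A),\ldots,\lambda_n(A))$ denotes the vector of eigenvalues of $A$, counted with multiplicity and ordered increasingly: $\lambda_1(A)\le\cdots\le\lambda_n(A)$. Variance majorization: for real vectors $x=(x_1,\ldots,x_n)$ and $y=(y_1,\ldots,y_n)$ ordered increasingly ($x_1\le\cdots\le x_n$ and $y_1\le\cdots\le y_n$), one writes $x\stackrel{vm}{\succ}y$ ($x$ variance majorizes $y$) if $$\sum_{i=1}^n x_i=\sum_{i=1}^n y_i,\qquad \mathrm{Var}(x)=\mathrm{Var}(y),\qquad \mathrm{Var}(x[k])\ge \mathrm{Var}(y[k])\ \text{ for } k=2,\ldots,n-1,$$ where $x[k]=(x_1,\ldots,x_k)$, $y[k]=(y_1,\ldots,y_k)$, and the variance of a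 real vector $z=(z_1,\ldots,z_k)$ is $\mathrm{Var}(z)=\frac1k\sum_{i=1}^k(z_i-\bar z)^2$ with $\bar z=\frac1k\sum_{i=1}^k z_i$. *)

(* Defs.v *)
From HB Require Import structures.
From mathcomp Require Import all_boot all_order all_algebra.
From mathcomp Require Import spectral sesquilinear polyrcf complex.
From mathcomp Require Import reals.

Set Implicit Arguments.
Unset Strict Implicit.
Unset Printing Implicit Defensive.

Import Order.TTheory GRing.Theory Num.Theory.
Local Open Scope ring_scope.

Definition correlation_mx (R : realType) (n : nat) (A : 'M[R]_n) : Prop :=
  [/\ A^T = A,
      forall v : 'cV[R]_n, 0 <= (v^T *m A *m v) 0 0
    & forall i, A i i = 1].

(* [rootsR p] lists the distinct roots of [p] in [R] in increasing order and
   [mup x p] is the multiplicity of [x] as a root of [p]. *)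
Definition real_eigenvalues (R : realType) (n : nat) (A : 'M[R]_n) : seq R :=
  flatten [seq nseq (mup x (char_poly A)) x | x <- rootsR (char_poly A)].

(* The default value 0 is used only when [A] has fewer than [n] real
   eigenvalues, hence never for symmetric [A]: see [eigenvalues_sym]. *)
Definition eigenvalues (R : realType) (n : nat) (A : 'M[R]_n) : n.-tuple R :=
  [tuple nth 0 (real_eigenvalues A) i | i < n].

Lemma char_poly_similar (F : fieldType) (n : nat) (P B D : 'M[F]_n) :
  P \in unitmx -> P *m B = D *m P -> char_poly B = char_poly D.
Proof.
move=> Punit PB; pose Q := map_mx (@polyC F) P.
have QV : Q *m map_mx (@polyC F) (invmx P) = 1%:M.
  by rewrite -map_mxM mulmxV // map_mx1.
have QE : Q *m char_poly_mx B = char_poly_mx D *m Q.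
  rewrite /char_poly_mx mulmxBr mulmxBl scalar_mxC; congr (_ - _).
  by rewrite -!map_mxM PB.
have detQ : \det Q != 0.
  have /(congr1 determinant) := QV; rewrite det_mulmx det1 => dQ.
  by apply/eqP => Q0; move/eqP: dQ; rewrite Q0 mul0r eq_sym oner_eq0.
apply: (mulfI detQ); rewrite /char_poly -det_mulmx QE det_mulmx.
exact: mulrC.
Qed.

Lemma char_poly_sym_split (R : realType) (n : nat) (A : 'M[R]_n) :
  A^T = A -> exists s : seq R, char_poly A = \prod_(x <- s) ('X - x%:P).
Proof.
move=> Asym; pose B := map_mx (real_complex R) A.
have Breal : B \is a realmx.
  by apply/mxOverP => i j; rewrite mxE complex_real.
have Bsym : B \is symmetricmx.
  by apply/is_hermitianmxP; rewrite expr0 scale1r map_mx_id // map_trmx Asym.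
have Bherm := realsym_hermsym Bsym Breal.
have /orthomx_spectralP BE := hermitian_normalmx Bherm.
have /mxOverP Dreal := hermitian_spectral_diag_real Bherm.
set P := spectralmx B in BE; set D := spectral_diag B in BE Dreal.
have Punit : P \in unitmx by exact: spectral_unit.
have PBD : char_poly B = char_poly (diag_mx D).
  apply: (char_poly_similar Punit).
  by rewrite [in LHS]BE mulmxA mulmxA mulmxV // mul1mx.
have Btrig : is_trig_mx (diag_mx D) by exact: diag_mx_is_trig.
exists [seq complex.Re (D 0 i) | i <- enum 'I_n].
apply: (@map_poly_inj _ _ (real_complex R)).
rewrite big_map big_enum /= map_char_poly PBD.
rewrite (char_poly_trig Btrig) rmorph_prod; apply: eq_bigr => i _ /=.
rewrite rmorphB /= map_polyX map_polyC /= mxE eqxx mulr1n.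
by rewrite RRe_real.
Qed.

Lemma eigenvalues_sym (R : realType) (n : nat) (A : 'M[R]_n) : A^T = A ->
  [/\ size (real_eigenvalues A) = n, sorted <=%R (eigenvalues A)
    & char_poly A = \prod_(x <- eigenvalues A) ('X - x%:P)].
Proof.
move=> /char_poly_sym_split[s cE].
have c0 : char_poly A != 0 by exact: (monic_neq0 (char_poly_monic A)).
have szs : size s = n.
  by have := size_char_poly A; rewrite cE size_prod_XsubC => -[].
have uniqR : uniq (rootsR (char_poly A)).
  exact: (sorted_uniq lt_trans (@ltxx _ _) (sorted_roots _ _ _)).
have cm x : count_mem x (real_eigenvalues A) = mup x (char_poly A).
  have mem : (x \in rootsR (char_poly A)) = root (char_poly A) x.
    by have := roots_on_rootsR c0 x; rewrite in_itv.
  rewrite /real_eigenvalues count_flatten -map_comp.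
  rewrite sumnE big_map.
  under eq_bigr => y _ do rewrite /= count_nseq /=.
  case: (boolP (x \in rootsR (char_poly A))) => xr.
    rewrite (bigD1_seq x) //= eqxx mul1n big1 ?addn0 // => y.
    by move=> /negbTE ->.
  rewrite mupNroot -?mem // big_seq big1 // => y yr.
  by case: eqP => // yx; rewrite -yx yr in xr.
have pE : perm_eq (real_eigenvalues A) s.
  by apply/allP => x _ /=; rewrite cm cE mu_prod_XsubC.
have szE : size (real_eigenvalues A) = n by rewrite (perm_size pE).
have eE : tval (eigenvalues A) = real_eigenvalues A.
  apply: (@eq_from_nth _ 0); first by rewrite size_tuple szE.
  move=> i; rewrite size_tuple => ltin.
  have := tnth_mktuple (fun j : 'I_n => nth 0 (real_eigenvalues A) j)
    (Ordinal ltin).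
  by rewrite (tnth_nth 0).
split => //; last by rewrite eE (perm_big _ pE) -cE.
rewrite eE /real_eigenvalues.
have := sorted_roots (- cauchy_bound (char_poly A))
  (cauchy_bound (char_poly A)) (char_poly A).
rewrite -/(rootsR _) !(sorted_pairwise lt_trans, sorted_pairwise le_trans).
elim: (rootsR _) => //= x r IH /andP[xr pr].
rewrite pairwise_cat IH // andbT; apply/andP; split.
  apply/allrelP => y z; rewrite mem_nseq => /andP[_ /eqP ->].
  case/flattenP => _ /mapP[t tr ->]; rewrite mem_nseq => /andP[_ /eqP ->].
  by apply: ltW; apply: (allP xr).
by elim: (mup _ _) => //= k ->; rewrite andbT all_nseq lexx orbT.
Qed.

Definition mean (R : realType) (z : seq R) : R :=
  (\sum_(t <- z) t) / (size z)%:R.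

Definition variance (R : realType) (z : seq R) : R :=
  (\sum_(t <- z) (t - mean z) ^+ 2) / (size z)%:R.

Definition variance_majorizes (R : realType) (n : nat) (x y : n.-tuple R) :
    Prop :=
  [/\ sorted <=%R x /\ sorted <=%R y,
      \sum_(t <- x) t = \sum_(t <- y) t,
      variance x = variance y
    & forall k, (2 <= k <= n - 1)%N ->
        variance (take k y) <= variance (take k x)].

Definition equicorrelation_mx (R : realType) (n : nat) (c : R) : 'M[R]_n :=
  \matrix_(i, j) (if i == j then 1 else c).

Definition rms_correlation (R : realType) (n : nat) (A : 'M[R]_n) : R :=
  Num.sqrt ((\sum_i \sum_(j | i != j) `|A i j| ^+ 2) / (n * (n - 1))%:R).

(* Main.v *)
(* The trace and the trace of the square fix the sum and the sum of squares of
   the eigenvalues, so all three spectra have the same mean and variance. The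
   matrix with off-diagonal r2 has spectrum (1 - r2, ..., 1 - r2, 1 + (n-1) r2),
   whose proper initial segments have variance 0. For the matrix with
   off-diagonal -r2 the spectrum is (1 - (n-1) r2, 1 + r2, ..., 1 + r2). Put
   S_k = k^2 Var (x[k]), the sum of (x_i - x_j)^2 over i < j <= k. For every
   increasing x the ratio S_k / (k - 1) is nondecreasing in k, and it is
   constant for a spectrum (a, b, ..., b). Comparing the values at k and at n
   gives the other majorization. *)
Require Import Defs.
From HB Require Import structures.
From mathcomp Require Import all_boot all_order all_algebra.
From mathcomp Require Import reals.
From mathcomp Require Import ring lra.

Set Implicit Arguments.
Unset Strict Implicit.
Unset Printing Implicit Defensive.

Import Order.TTheory GRing.Theory Num.Theory.
Local Open Scope ring_scope.

(** * Power sums of eigenvalues as traces *)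

Lemma mxtrace_prod_XsubC (F : idomainType) (n : nat) (B : 'M[F]_n)
    (s : seq F) :
  char_poly B = \prod_(x <- s) ('X - x%:P) -> \tr B = \sum_(x <- s) x.
Proof.
move=> cB.
have szs : size s = n.
  by have := size_char_poly B; rewrite cB size_prod_XsubC => -[].
have [n0|n_gt0] := posnP n.
  have -> : s = [::] by apply/nilP; rewrite /nilp szs n0.
  rewrite big_nil /mxtrace big1 // => -[k kn] _.
  by have := kn; rewrite [X in (_ < X)%N -> _]n0 ltn0.
(* Both sides, negated, are the coefficient of degree [n - 1]. *)
apply: oppr_inj; rewrite -(char_poly_trace B n_gt0) cB -szs.
by rewrite coefPn_prod_XsubC // szs -lt0n.
Qed.

(* Substituting 'X^2 in the characteristic polynomial of B^2 factors it as
   det (X - B) det (X + B). *)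
Lemma char_poly_sqr_prod_XsubC (F : idomainType) (n : nat) (B : 'M[F]_n)
    (s : seq F) :
  char_poly B = \prod_(x <- s) ('X - x%:P) ->
  char_poly (B *m B) = \prod_(x <- [seq y ^+ 2 | y <- s]) ('X - x%:P).
Proof.
move=> cB.
have szs : size s = n.
  by have := size_char_poly B; rewrite cB size_prod_XsubC => -[].
(* ['X^2 - B^2 = - ('X - B) (- 'X - B)]; the sign becomes [(-1) ^+ n] under [\det]. *)
have E : map_mx (comp_poly 'X^2) (char_poly_mx (B *m B)) =
    - (char_poly_mx B *m map_mx (comp_poly (- 'X)) (char_poly_mx B)).
  have mapE q : map_mx (comp_poly q) (char_poly_mx B) =
      q%:M - map_mx polyC B.
    rewrite /char_poly_mx map_mxB map_scalar_mx /= comp_polyX; congr (_ - _).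
    by apply/matrixP => i j; rewrite !mxE /= comp_polyC.
  rewrite mapE /char_poly_mx map_mxB map_scalar_mx /= comp_polyX.
  have -> : map_mx (comp_poly 'X^2) (map_mx polyC (B *m B)) =
      map_mx polyC B *m map_mx polyC B.
    by rewrite -map_mxM; apply/matrixP => i j; rewrite !mxE /= comp_polyC.
  rewrite mulmxBl !mulmxBr -scalar_mxM mul_mx_scalar mul_scalar_mx.
  by apply/matrixP => i j; rewrite !mxE; case: (i == j);
    rewrite ?mulr1n ?mulr0n; ring.
have detE : char_poly (B *m B) \Po 'X^2 =
    (-1) ^+ n * (char_poly B * (char_poly B \Po (- 'X))).
  by rewrite /char_poly -!det_map_mx E -scaleN1r detZ det_mulmx.
(* Composition with the nonconstant ['X^2] is injective, so the identity may be checked after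
   substitution. *)
apply/eqP; rewrite -subr_eq0 -(@comp_poly_eq0 _ _ 'X^2) ?size_polyXn //.
rewrite rmorphB /= detE subr_eq0 cB !rmorph_prod /= big_map -szs.
apply/eqP; elim: s {cB szs} => [|x s IH]; first by rewrite !big_nil !mulr1.
rewrite !big_cons -IH /= !comp_polyB !comp_polyX !comp_polyC exprS polyC_exp.
ring.
Qed.

(** Both sides are the trace of [A *m A]; symmetry turns [A i j * A j i] into a square. *)
Lemma sum_sqr_eigenvalues (R : realType) (n : nat) (A : 'M[R]_n) : A^T = A ->
  \sum_(x <- eigenvalues A) x ^+ 2 = \sum_i \sum_j A i j ^+ 2.
Proof.
move=> As; have [_ _ cE] := eigenvalues_sym As.
have := mxtrace_prod_XsubC (char_poly_sqr_prod_XsubC cE).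
rewrite big_map => <-; apply: eq_bigr => i _; rewrite mxE.
by apply: eq_bigr => j _; rewrite -[in X in _ * X]As mxE.
Qed.

(** Unique factorization fixes the roots up to order and sortedness fixes the order, so a guessed
    spectrum only has to be verified. *)
Lemma eigenvalues_sorted_prod (R : realType) (n : nat) (A : 'M[R]_n)
    (s : seq R) :
  A^T = A -> sorted <=%R s -> char_poly A = \prod_(x <- s) ('X - x%:P) ->
  eigenvalues A = s :> seq R.
Proof.
move=> As ss cs; have [_ se cE] := eigenvalues_sym As.
apply: (sorted_eq le_trans le_anti se ss).
by apply: prod_XsubC_eq; rewrite -cE.
Qed.

(** * Spectra of equicorrelation matrices *)

Lemma equicorrelation_mx_sym (R : realType) (n : nat) (c : R) :
  (equicorrelation_mx n c)^T = equicorrelation_mx n c.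
Proof. by apply/matrixP => i j; rewrite !mxE eq_sym. Qed.

(* P has first row all ones and the identity below it: it conjugates the
   all-ones matrix to one supported in the first column, so that D is lower
   triangular. *)
Lemma char_poly_equicorrelation (R : realType) (m : nat) (c : R) :
  char_poly (equicorrelation_mx m.+1 c) =
  ('X - (1 + m%:R * c)%:P) * ('X - (1 - c)%:P) ^+ m.
Proof.
pose P : 'M[R]_m.+1 := \matrix_(i, j) ((i == j) || (i == 0))%:R.
pose D : 'M[R]_m.+1 := \matrix_(i, j)
  ((i == j)%:R * (1 - c) + (j == 0)%:R * c * (if i == 0 then m.+1%:R else 1)).
have Punit : P \in unitmx.
  (* [is_trig_mx] means lower triangular and [P] is upper triangular, hence the transpose. *)
  rewrite -unitmx_tr unitmxE det_trig.
    by rewrite big1 ?unitr1 // => i _; rewrite !mxE eqxx.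
  apply/is_trig_mxP => i j ij; rewrite !mxE.
  have /negbTE -> : j != i by apply: contraTneq ij => ->; rewrite ltnn.
  by have /negbTE -> : j != 0 by apply: contraTneq ij => ->; rewrite ltn0.
have PD : P *m equicorrelation_mx m.+1 c = D *m P.
  apply/matrixP => i j; rewrite !mxE.
  under eq_bigr => k _ do rewrite !mxE.
  under [RHS]eq_bigr => k _ do rewrite !mxE.
  (* Row [i] of [D] is supported in columns [i] and 0, so the sum splits into two Kronecker
     deltas. *)
  rewrite [RHS](eq_bigr (fun k : 'I_m.+1 =>
    (k == i)%:R * ((1 - c) * ((i == j) || (i == 0))%:R) +
    (k == 0)%:R * (c * (if i == 0 then m.+1%:R else 1)))); last first.
    move=> k _; rewrite [i == k]eq_sym; have [->|ki] := eqVneq k i.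
      have [->|i0] := eqVneq i 0.
        by rewrite !orbT /= !mulr1n; ring.
      by rewrite /= ?mulr1n ?mulr0n; ring.
    have [->|k0] := eqVneq k 0.
      by rewrite !orbT /= !mulr1n ?mulr0n; ring.
    by rewrite /= ?mulr1n ?mulr0n; ring.
  have sum1 (x : 'I_m.+1) (a : R) : \sum_(k < m.+1) (k == x)%:R * a = a.
    rewrite (bigD1 x) //= eqxx mul1r big1 ?addr0 // => k /negbTE ->.
    by rewrite mul0r.
  rewrite [RHS]big_split /= !sum1.
  have [->|i0] := eqVneq i 0.
    rewrite orbT (eq_bigr (fun k : 'I_m.+1 => (k == j)%:R * (1 - c) + c)).
      by rewrite big_split /= sum1 sumr_const card_ord -[c *+ _]mulr_natr; ring.
    by move=> k _; rewrite orbT; case: eqP => _;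
      rewrite /= ?mulr1n ?mulr0n; ring.
  rewrite orbF (eq_bigr (fun k : 'I_m.+1 => (k == i)%:R *
    (if i == j then 1 else c))).
    by rewrite sum1; case: eqP => _; rewrite /= ?mulr1n ?mulr0n; ring.
  move=> k _; rewrite orbF [i == k]eq_sym.
  by have [->|_] := eqVneq k i => //; rewrite !mul0r.
rewrite (char_poly_similar Punit PD) char_poly_trig; last first.
  apply/is_trig_mxP => i j ij; rewrite !mxE.
  have /negbTE -> : i != j by apply: contraTneq ij => ->; rewrite ltnn.
  have /negbTE -> : j != 0 by apply: contraTneq ij => ->; rewrite ltn0.
  by rewrite !mul0r add0r.
rewrite big_ord_recl; congr (_ * _).
  by rewrite !mxE !eqxx -[m.+1%:R]natr1 !mulr1n; congr ('X - polyC _); ring.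
rewrite (eq_bigr (fun=> 'X - (1 - c)%:P)) ?prodr_const ?card_ord // => i _.
by rewrite !mxE eqxx /= !mul0r addr0 mul1r.
Qed.

(** The sign of [c] decides whether the eigenvalue of the all-ones vector comes last, as here, or
    first. *)
Lemma eigenvalues_equicorrelation_ge0 (R : realType) (n : nat) (c : R) :
  (0 < n)%N -> 0 <= c ->
  eigenvalues (equicorrelation_mx n c) =
    rcons (nseq n.-1 (1 - c)) (1 + n.-1%:R * c) :> seq R.
Proof.
case: n => // m _ c0; apply: eigenvalues_sorted_prod.
- exact: equicorrelation_mx_sym.
- rewrite (sorted_pairwise le_trans) pairwise_rcons all_nseq; apply/andP.
  split.
    by apply/orP; right; apply: lerD => //; apply: le_trans (_ : 0 <= _);
      rewrite ?oppr_le0 ?mulr_ge0.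
  by elim: m => //= m ->; rewrite all_nseq lexx orbT.
- rewrite big_rcons /= char_poly_equicorrelation big_nseq mulrC.
  by rewrite iter_mulr_1.
Qed.

Lemma eigenvalues_equicorrelation_le0 (R : realType) (n : nat) (c : R) :
  (0 < n)%N -> c <= 0 ->
  eigenvalues (equicorrelation_mx n c) =
    1 + n.-1%:R * c :: nseq n.-1 (1 - c) :> seq R.
Proof.
case: n => // m _ c0; apply: eigenvalues_sorted_prod.
- exact: equicorrelation_mx_sym.
- rewrite (sorted_pairwise le_trans) /= all_nseq; apply/andP; split.
    by apply/orP; right; apply: lerD => //; apply: le_trans (_ : 0 <= _);
      rewrite ?oppr_ge0 ?mulr_ge0_le0.
  by elim: m => //= m ->; rewrite all_nseq lexx orbT.
- by rewrite big_cons char_poly_equicorrelation big_nseq iter_mulr_1.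
Qed.

(** * Growth of the spread along an increasing list *)

Section Spread.
Variable R : realType.
Implicit Types (z : seq R) (a b : R).

(* By Lagrange's identity this is the sum of (z_i - z_j)^2 over i < j. *)
Definition spread z : R :=
  (size z)%:R * (\sum_(t <- z) t ^+ 2) - (\sum_(t <- z) t) ^+ 2.

Lemma sum_sqr_sub z a :
  \sum_(t <- z) (a - t) ^+ 2 =
  (size z)%:R * a ^+ 2 - 2 * a * (\sum_(t <- z) t) + \sum_(t <- z) t ^+ 2.
Proof.
elim: z => [|t r IH]; first by rewrite !big_nil /=; ring.
by rewrite !big_cons IH /= -natr1; ring.
Qed.

(** For lists of equal length, comparing variances thus reduces to comparing spreads, which are free
    of division. *)
Lemma varianceE z : variance z = spread z / (size z)%:R ^+ 2.
Proof.
rewrite /variance /mean /spread.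
have [/size0nil ->|s_gt0] := posnP (size z).
  by rewrite !big_nil; ring.
have s0 : (size z)%:R != 0 :> R by rewrite pnatr_eq0 -lt0n.
under eq_bigr => t _ do rewrite -sqrrN opprB.
by rewrite sum_sqr_sub; field.
Qed.

Lemma spread_cons z a :
  spread (a :: z) = spread z + \sum_(t <- z) (a - t) ^+ 2.
Proof. by rewrite sum_sqr_sub /spread !big_cons /= -natr1; ring. Qed.

Lemma spread_rcons z a :
  spread (rcons z a) = spread z + \sum_(t <- z) (a - t) ^+ 2.
Proof.
have p : perm_eq (rcons z a) (a :: z) by rewrite perm_rcons.
by rewrite -spread_cons /spread (perm_size p) !(perm_big _ p).
Qed.

(** Reflection only changes the signs of the differences; it turns entries at most [a] into
    nonnegative ones. *)
Lemma spread_subl z a : spread [seq a - t | t <- z] = spread z.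
Proof.
rewrite /spread size_map !big_map sum_sqr_sub.
have -> : \sum_(t <- z) (a - t) = (size z)%:R * a - \sum_(t <- z) t.
  elim: z => [|t r IH]; first by rewrite !big_nil /=; ring.
  by rewrite !big_cons IH /= -natr1; ring.
ring.
Qed.

(** The cross terms of the expanded square are nonnegative. *)
Lemma sum_sqr_le_sqr_sum z : all (>= 0) z ->
  \sum_(t <- z) t ^+ 2 <= (\sum_(t <- z) t) ^+ 2.
Proof.
elim: z => [|t r IH] /=; first by rewrite !big_nil expr0n.
case/andP => t0 r0; rewrite !big_cons.
have : 0 <= \sum_(x <- r) x by rewrite big_seq sumr_ge0 // => x /(allP r0).
by have := IH r0; nra.
Qed.

(* With u_i = a - z_i >= 0 and N = size z, the claim is spread u <= (N - 1)
   sum u_i^2, which holds because sum u_i^2 <= (sum u_i)^2. *)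
Lemma spread_rcons_ge z a : all (<= a) z ->
  (size z)%:R * spread z <=
  (size z)%:R * spread (rcons z a) - spread (rcons z a).
Proof.
move=> za; have := spread_subl z a; rewrite {1}/spread size_map big_map.
have := @sum_sqr_le_sqr_sum [seq a - t | t <- z].
rewrite all_map (eq_all (a2 := <= a)) => [/(_ za)|t]; last exact: subr_ge0.
rewrite spread_rcons big_map; nra.
Qed.

(** Induction from the right end: [spread_rcons_ge] is one step of the monotonicity of
    [S_k / (k - 1)], here with denominators cleared. *)
Lemma spread_take_le z k : sorted <=%R z -> (1 < k <= size z)%N ->
  ((size z).-1)%:R * spread (take k z) <= (k.-1)%:R * spread z.
Proof.
move=> + /andP[k1]; elim/last_ind: z => [|z a IH] sz.
  by rewrite leqNgt (ltn_trans _ k1).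
rewrite size_rcons /= leq_eqVlt => /orP[/eqP kz|].
  by rewrite take_oversize ?size_rcons ?kz.
rewrite ltnS => kz; rewrite -cats1 takel_cat // cats1.
move: sz; rewrite (sorted_pairwise le_trans) pairwise_rcons => /andP[za pz].
rewrite -(sorted_pairwise le_trans) in pz.
have step := spread_rcons_ge za; have {IH} := IH pz kz.
have s1 : (1 < size z)%N by exact: leq_trans kz.
have N0 : 0 < (size z).-1%:R :> R by rewrite ltr0n -ltnS prednK // ltnW.
have K0 : 0 <= k.-1%:R :> R by [].
move: step; have -> : (size z)%:R = (size z).-1%:R + 1 :> R.
  by rewrite natr1 prednK // ltnW.
move: ((size z).-1%:R : R) (k.-1%:R : R) N0 K0 => N K N0 K0 step IH.
have {}step : (N + 1) * spread z <= N * spread (rcons z a) by lra.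
(* After scaling by [N > 0], [IH] gives the first half of the chain and [step], scaled by [K], the
   second. *)
rewrite -(ler_pM2l N0) mulrCA.
apply: le_trans (_ : (N + 1) * (K * spread z) <= _).
  by rewrite ler_pM2l //; lra.
by rewrite mulrCA [leRHS]mulrCA ler_wpM2l.
Qed.

Lemma spread_nseq m a : spread (nseq m a) = 0.
Proof.
elim: m => [|m IH]; first by rewrite /spread !big_nil /=; ring.
by rewrite spread_cons IH big_nseq iter_addr_0 subrr; ring.
Qed.

Lemma spread_cons_nseq m a b :
  spread (a :: nseq m b) = m%:R * (a - b) ^+ 2.
Proof.
by rewrite spread_cons spread_nseq add0r big_nseq iter_addr_0 mulr_natl.
Qed.

Lemma spread_ge0 z : 0 <= spread z.
Proof.
elim: z => [|a z IH]; first by rewrite /spread !big_nil /= mulr0 expr0n subrr.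
by rewrite spread_cons addr_ge0 // sumr_ge0 // => t _; rewrite sqr_ge0.
Qed.

End Spread.

(** * Root mean square correlation and the spread of the spectrum *)

Lemma sum_sqr_correlation (R : realType) (n : nat) (A : 'M[R]_n) :
  (2 <= n)%N -> (forall i, A i i = 1) ->
  \sum_i \sum_j A i j ^+ 2 =
    n%:R + (n * (n - 1))%:R * rms_correlation A ^+ 2.
Proof.
move=> n2 A1; rewrite /rms_correlation sqr_sqrtr; last first.
  rewrite divr_ge0 // sumr_ge0 // => i _; rewrite sumr_ge0 // => j _.
  exact: exprn_ge0.
rewrite mulrC divfK; last first.
  by rewrite pnatr_eq0 muln_eq0 negb_or -!lt0n subn_gt0 n2 ltnW.
rewrite -[X in X%:R]card_ord -sumr_const -big_split; apply: eq_bigr => i _ /=.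
rewrite (bigD1 i) //= A1 expr1n; congr (_ + _).
rewrite (eq_bigl (fun j => i != j)) => [|j]; last by rewrite eq_sym.
by apply: eq_bigr => j _; rewrite real_normK ?num_real.
Qed.

(** This gives [A_hat] and [A_bar] the same root mean square [r2] as [A], hence the same spread of
    eigenvalues. *)
Lemma rms_equicorrelation_mx (R : realType) (n : nat) (c : R) :
  (2 <= n)%N -> rms_correlation (equicorrelation_mx n c) = `|c|.
Proof.
move=> n2; rewrite /rms_correlation -sqrtr_sqr; congr Num.sqrt.
apply: (canLR (mulfK _)).
  by rewrite pnatr_eq0 muln_eq0 negb_or -!lt0n subn_gt0 n2 ltnW.
rewrite (eq_bigr (fun=> c ^+ 2 *+ (n - 1))) => [|i _].
  by rewrite sumr_const card_ord -mulrnA mulr_natr mulnC.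
rewrite (eq_bigr (fun=> c ^+ 2)) => [|j /negbTE ij].
  rewrite sumr_const; congr (_ *+ _).
  rewrite (eq_card (B := predC1 i)) => [|j]; last by rewrite !inE eq_sym.
  by rewrite cardC1 card_ord subn1.
by rewrite mxE ij real_normK ?num_real.
Qed.

(** The eigenvalues have sum [n] and sum of squares [n + n (n - 1) r^2], where [r] is
    [rms_correlation A]; so their spread depends on [A] only through [r]. *)
Lemma spread_eigenvalues (R : realType) (n : nat) (A : 'M[R]_n) :
  (2 <= n)%N -> A^T = A -> (forall i, A i i = 1) ->
  spread (eigenvalues A) = (n * (n * (n - 1)))%:R * rms_correlation A ^+ 2.
Proof.
move=> n2 As A1; have [_ _ /mxtrace_prod_XsubC trA] := eigenvalues_sym As.
rewrite /spread size_tuple -trA sum_sqr_eigenvalues // sum_sqr_correlation //.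
rewrite /mxtrace (eq_bigr (fun=> 1)) // sumr_const card_ord natrM; ring.
Qed.

Theorem theorem1p1 (R : realType) (n : nat) (A : 'M[R]_n) :
  (2 <= n)%N ->
  correlation_mx A ->
  let r2 := rms_correlation A in
  let A_hat := equicorrelation_mx n r2 in
  let A_bar := equicorrelation_mx n (- r2) in
  variance_majorizes (eigenvalues A_bar) (eigenvalues A) /\
  variance_majorizes (eigenvalues A) (eigenvalues A_hat).
Proof.
move=> n2 [As _ A1] r2 A_hat A_bar.
have r2_ge0 : 0 <= r2 by exact: sqrtr_ge0.
have equi1 c i : equicorrelation_mx n c i i = 1 by rewrite mxE eqxx.
have sorted_ev (B : 'M[R]_n) : B^T = B -> sorted <=%R (eigenvalues B).
  by case/eigenvalues_sym.
have sum_ev (B : 'M[R]_n) : B^T = B -> (forall i, B i i = 1) ->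
    \sum_(t <- eigenvalues B) t = n%:R.
  move=> Bs B1; have [_ _ /mxtrace_prod_XsubC <-] := eigenvalues_sym Bs.
  by rewrite /mxtrace (eq_bigr (fun=> 1)) // sumr_const card_ord.
have spread_ev c : `|c| = r2 ->
    spread (eigenvalues (equicorrelation_mx n c)) = spread (eigenvalues A).
  move=> cr; rewrite !spread_eigenvalues ?rms_equicorrelation_mx ?cr //.
  exact: equicorrelation_mx_sym.
have hat_s : A_hat^T = A_hat by exact: equicorrelation_mx_sym.
have bar_s : A_bar^T = A_bar by exact: equicorrelation_mx_sym.
have hat1 i : A_hat i i = 1 by exact: equi1.
have bar1 i : A_bar i i = 1 by exact: equi1.
have spread_hat := spread_ev r2 (ger0_norm r2_ge0).
have spread_bar : spread (eigenvalues A_bar) = spread (eigenvalues A).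
  by apply: spread_ev; rewrite normrN ger0_norm.
have var_le k (x y : n.-tuple R) : (k <= n)%N ->
    spread (take k y) <= spread (take k x) ->
    variance (take k y) <= variance (take k x).
  by move=> kn xy; rewrite !varianceE !size_takel ?size_tuple // ler_wpM2r //
    invr_ge0 exprn_ge0.
have k_le k : (2 <= k <= n - 1)%N -> (k < n)%N.
  by case/andP=> _; rewrite subn1 -ltnS prednK // ltnW.
split; split.
- by split; exact: sorted_ev.
- by rewrite !sum_ev.
- by rewrite !varianceE !size_tuple spread_bar.
- move=> k kn; have lt_kn := k_le k kn; apply: var_le (ltnW lt_kn) _.
  have := @spread_take_le R (eigenvalues A) k (sorted_ev _ As).
  rewrite size_tuple (ltnW lt_kn); case/andP: kn => k2 _.
  rewrite k2 -spread_bar => /(_ isT).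
  have bar_eq : eigenvalues A_bar =
      1 + n.-1%:R * - r2 :: nseq n.-1 (1 - - r2) :> seq R.
    by apply: eigenvalues_equicorrelation_le0; rewrite ?oppr_le0 // ltnW.
  have -> : take k (eigenvalues A_bar) =
      1 + n.-1%:R * - r2 :: nseq k.-1 (1 - - r2).
    rewrite bar_eq -[k in LHS]prednK ?(ltnW k2) //= take_nseq //.
    by rewrite -subn1 -[n.-1]subn1 leq_sub2r // ltnW.
  (* Both spreads of [A_bar] are multiples of one square, by [k - 1] and by [n - 1]; the positive
     factor [n - 1] cancels. *)
  rewrite bar_eq !spread_cons_nseq mulrCA ler_pM2l // ltr0n -subn1.
  by rewrite subn_gt0.
- by split; exact: sorted_ev.
- by rewrite !sum_ev.
- by rewrite !varianceE !size_tuple spread_hat.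
- move=> k kn; have lt_kn := k_le k kn; apply: var_le (ltnW lt_kn) _.
  (* This bound keeps the segment clear of the largest eigenvalue, so it is constant. *)
  have k_le_n1 : (k <= n.-1)%N by case/andP: kn; rewrite subn1.
  have hat_eq : eigenvalues A_hat =
      rcons (nseq n.-1 (1 - r2)) (1 + n.-1%:R * r2) :> seq R.
    by apply: eigenvalues_equicorrelation_ge0; rewrite // ltnW.
  rewrite hat_eq -cats1 takel_cat ?size_nseq // take_nseq // spread_nseq.
  exact: spread_ge0.
Qed.
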